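(* An Abelian topological group $X$ is compact if and only if $X$ is complete in each weaker Hausdorff group topology, i.e. for every Hausdorff group topology $\tau$ on the group $X$ that is contained in the topology of $X$, the topological group $(X,\tau)$ is complete.
   Context: All topological groups are assumed to be Hausdorff. A topological group is complete if it is complete in its two-sided uniformity. ''Weaker'' is not meant strictly: the original topology of $X$ is among the weaker topologies. *)

(* Defs.v *)
From HB Require Import structures.
From mathcomp Require Import all_boot all_order all_algebra.
From mathcomp Require Import all_classical topology tvs.

Set Implicit Arguments.
Unset Strict Implicit.
Unset Printing Implicit Defensive.

Import GRing.Theory.
Local Open Scope classical_set_scope.
Local Open Scope ring_scope.

(* A topology on a fixed set, given by its open sets.  The empty set is open as
   the union of the empty family. *)
Record topologyOn (T : Type) := TopologyOn {
  opens :> set_system T ;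
  opensT : opens [set: T] ;
  opensI : setI_closed opens ;
  opens_bigcup : forall S : set_system T,
    S `<=` opens -> opens (\bigcup_(A in S) A)
}.

(* Type alias: the group X carrying the topology tau. *)
Definition retopologize (X : zmodType) (tau : topologyOn X) : Type := X.

Section Retopologize.
Variables (X : zmodType) (tau : topologyOn X).

HB.instance Definition _ := GRing.Zmodule.on (retopologize tau).

Let opens_bigcup_indexed (I : Type) (f : I -> set (retopologize tau)) :
  (forall i, opens tau (f i)) -> opens tau (\bigcup_i f i).
Proof.
move=> tf; have -> : \bigcup_i f i = \bigcup_(A in range f) A.
  by rewrite bigcup_image.
by apply: opens_bigcup => _ [i _ <-].
Qed.

HB.instance Definition _ := isOpenTopological.Build (retopologize tau)
  (opensT tau) (@opensI _ tau) opens_bigcup_indexed.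

End Retopologize.

Lemma open_retopologizeE (X : zmodType) (tau : topologyOn X) :
  @open (retopologize tau) = opens tau.
Proof. by []. Qed.

Record groupTopology (X : zmodType) := GroupTopology {
  group_topology :> topologyOn X ;
  group_topology_add : continuous
    (fun x : retopologize group_topology * retopologize group_topology =>
       x.1 + x.2) ;
  group_topology_opp : continuous
    (-%R : retopologize group_topology -> retopologize group_topology)
}.

(* Type alias: the topological group (X, tau). *)
Definition with_topology (X : zmodType) (tau : groupTopology X) : Type :=
  retopologize tau.

Section WithTopology.
Variables (X : zmodType) (tau : groupTopology X).

HB.instance Definition _ := GRing.Zmodule.on (with_topology tau).
HB.instance Definition _ := Topological.copy (with_topology tau)
  (retopologize tau).
HB.instance Definition _ := PreTopologicalNmodule_isTopologicalNmodule.Build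
  (with_topology tau) (@group_topology_add X tau).
HB.instance Definition _ := TopologicalNmodule_isTopologicalZmodule.Build
  (with_topology tau) (@group_topology_opp X tau).

End WithTopology.

Lemma open_with_topologyE (X : zmodType) (tau : groupTopology X) :
  @open (with_topology tau) = opens tau.
Proof. by []. Qed.

(* Type alias: the topological group G carrying its two-sided uniformity, which
   is generated by the sets {(x, y) | y \in (x + U) `&` (U + x)} with U a
   neighbourhood of 0. *)
Definition two_sided (G : topologicalZmodType) : Type := G.

Section TwoSided.
Variable G : topologicalZmodType.

HB.instance Definition _ := TopologicalZmodule.copy (two_sided G) G.

Definition two_sided_entourage : set_system (two_sided G * two_sided G) :=
  [set A | exists2 U : set G, nbhs (0 : G) U &
     [set xy : G * G | U (- xy.1 + xy.2) /\ U (xy.2 - xy.1)] `<=` A].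

Let entourage_filter : Filter two_sided_entourage.
Proof.
split.
- by exists setT => //; exact: filterT.
- move=> A B [U U0 UA] [V V0 VB]; exists (U `&` V); first exact: filterI.
  by move=> xy [[? ?] [? ?]]; split; [exact: UA|exact: VB].
- by move=> A B AB [U U0 UA]; exists U => // xy /UA/AB.
Qed.

Let entourage_diagonal (A : set (two_sided G * two_sided G)) :
  two_sided_entourage A -> diagonal `<=` A.
Proof.
move=> [U U0 UA] [x y] /= xy; rewrite /diagonal /= in xy; subst y; apply: UA.
by rewrite /= addNr subrr; split; exact: nbhs_singleton.
Qed.

Let entourage_inv (A : set (two_sided G * two_sided G)) :
  two_sided_entourage A -> two_sided_entourage A^-1%relation.
Proof.
move=> [U U0 UA]; exists (-%R @^-1` U).
  by apply: (@opp_continuous G 0); rewrite /= oppr0.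
move=> [x y] /= [Ux Uy]; apply: UA => /=; split.
  by move: Ux; rewrite opprD opprK addrC.
by rewrite -opprB.
Qed.

Let entourage_split (A : set (two_sided G * two_sided G)) :
  two_sided_entourage A ->
  exists2 B, two_sided_entourage B & (B \; B)%relation `<=` A.
Proof.
move=> [U U0 UA].
have := @add_continuous G (0, 0); rewrite /continuous_at /= addr0.
move=> /(_ U U0) [[V W] /= [V0 W0] VWU].
pose B := [set xy : G * G |
  (V `&` W) (- xy.1 + xy.2) /\ (V `&` W) (xy.2 - xy.1)].
exists B; first by exists (V `&` W) => //; exact: filterI.
move=> [x y] /= [z [[V1 W1] [V2 W2]] [[V3 W3] [V4 W4]]]; apply: UA => /=; split.
  have -> : - x + y = (- x + z) + (- z + y) by rewrite addrA addrK.
  exact: (VWU (- x + z, - z + y)).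
have -> : y - x = (y - z) + (z - x) by rewrite addrA subrK.
exact: (VWU (y - z, z - x)).
Qed.

Let entourage_nbhs : nbhs = nbhs_ two_sided_entourage.
Proof.
have addl_cont (a : G) : continuous (fun y : G => a + y).
  move=> y; apply: (@continuous_comp _ _ _ (fun y => (a, y))
    (fun x : G * G => x.1 + x.2)); last exact: add_continuous.
  by apply: cvg_pair => /=; [exact: cvg_cst|exact: cvg_id].
rewrite funeqE => x; rewrite eqEsubset; split=> A.
- move=> xA; exists [set xy : G * G | A (x + (- xy.1 + xy.2))].
    exists [set u | A (x + u)].
      by apply: (@addl_cont x 0); rewrite /= addr0.
    by move=> [a b] /= [].
  by move=> y; rewrite /xsection /= inE /= addrA subrr add0r.
- move=> [B [U U0 UB] BA].
  have : nbhs x [set y | U (- x + y)].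
    by apply: (@addl_cont (- x) x); rewrite /= addNr.
  apply: filterS => y Uy; apply: BA; rewrite /xsection /= inE.
  by apply: UB => /=; split=> //; rewrite addrC.
Qed.

HB.instance Definition _ := Nbhs_isUniform_mixin.Build (two_sided G)
  entourage_filter entourage_diagonal entourage_inv entourage_split
  entourage_nbhs.

End TwoSided.

Definition group_complete (G : topologicalZmodType) :=
  forall F : set_system (two_sided G),
    ProperFilter F -> cauchy F -> exists x : two_sided G, F --> x.

(* Main.v *)
Require Import Defs.
From mathcomp Require Import all_boot all_order all_algebra.
From mathcomp Require Import all_classical topology tvs.
From mathcomp Require Import reals normedtype Rstruct zify ring lra.

(* Suppose that X is complete in all weaker Hausdorff group topologies but is not
   totally bounded.  Call q rigid if, modulo qX and some neighbourhood of 0, no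
   dX with d a proper divisor of q is covered by finitely many translates.
   Choosing x_i generically, an approximate relation sum_i c_i x_i = 0 with |c_i|
   small compared to i forces q to divide all the c_i, for every rigid q.

   Enlarge the neighbourhoods of 0 by the combinations sum_i c_i x_i with
   sum_i c_i = 0 and |c_i| <= i / 2^m, so that (x_i) becomes Cauchy.  A limit of
   (x_i) would be approximated by combinations with sum_i c_i = 1 and with all c_i
   divisible by a rigid q <> 1, which is absurd.  A point a in all the enlarged
   neighbourhoods is approximated by combinations q * sum_i d_i x_i with
   sum_i d_i = 0, for every rigid q.  Given U, there is a rigid q such that qX is
   covered by finitely many translates of U, and by a theorem of Bogolyubov and
   Folner the discrete group X has a totally bounded group topology in which
   {y | q y in U} is a neighbourhood of 0.  The x_i converge in its completion
   along an ultrafilter, so only combinations that are small for that topology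
   need to be added, and these give a in U.  Hence the new topology is Hausdorff,
   and X is not complete in it. *)

Set Implicit Arguments.
Unset Strict Implicit.
Unset Printing Implicit Defensive.

Import Order.TTheory GRing.Theory Num.Theory numFieldNormedType.Exports.

Local Open Scope classical_set_scope.
Local Open Scope ring_scope.

(** * Invariant means on abelian groups *)

Lemma fmap_ultra (T U : Type) (f : T -> U) (F : set_system T) :
  UltraFilter F -> UltraFilter (fmap f F).
Proof.
move=> UF; split=> [|G GP FG]; first exact: fmap_proper_filter.
rewrite eqEsubset; split=> // B GB.
have [//|/= nB] := in_ultra_setVsetC (f @^-1` B) UF.
have GnB : G (~` B) by exact: FG.
by case: (filter_ex (filterI GB GnB)) => x [].
Qed.

Section InvariantMean.
Variables (R : realType) (A : zmodType).
Implicit Types (g h : A -> R) (s : seq A).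

(** The mean of [g] over the combinations of [s] with coefficients in [[0, n)], counted with
    multiplicity; such boxes play the role of Folner sets. *)
Fixpoint box_average (n : nat) (s : seq A) (g : A -> R) : R :=
  if s is a :: s' then
    n%:R^-1 * \sum_(k < n) box_average n s' (fun z => g (z + a *+ k))
  else g 0.

Lemma box_averageD n s g h : box_average n s (fun z => g z + h z) =
  box_average n s g + box_average n s h.
Proof.
elim: s g h => [//|a s IH] g h /=.
by rewrite -mulrDr -big_split; congr (_ * _); apply: eq_bigr => k _; exact: IH.
Qed.

Lemma box_average_le n s g h : (forall z, g z <= h z) ->
  box_average n s g <= box_average n s h.
Proof.
elim: s g h => [|a s IH] g h gh //=.
by apply: ler_wpM2l; rewrite ?invr_ge0// ler_sum// => k _; exact: IH.
Qed.

Lemma box_average_cst n s c : (0 < n)%N -> box_average n s (fun=> c) = c.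
Proof.
move=> n0; elim: s => [//|a s IH] /=.
rewrite (eq_bigr (fun=> c)) ?sumr_const ?card_ord//.
by rewrite -[c *+ n]mulr_natl mulKf// pnatr_eq0 -lt0n.
Qed.

Lemma box_average01 n s g : (0 < n)%N -> (forall z, 0 <= g z <= 1) ->
  0 <= box_average n s g <= 1.
Proof.
move=> n0 g01; apply/andP; split.
  rewrite -[leLHS](box_average_cst s 0 n0).
  by apply: box_average_le => z; case/andP: (g01 z).
rewrite -[leRHS](box_average_cst s 1 n0).
by apply: box_average_le => z; case/andP: (g01 z).
Qed.

(** In the direction of [a] the difference telescopes to two end terms in [[0, 1]], divided by [n];
    averaging over the other directions keeps the bound. *)
Lemma box_average_shift n s g a : (0 < n)%N -> a \in s ->
  (forall z, 0 <= g z <= 1) ->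
  `|box_average n s (fun z => g (z + a)) - box_average n s g| <= n%:R^-1.
Proof.
move=> n0; elim: s g => [//|b s IH] g; rewrite inE => /orP[/eqP->|asn] g01 /=.
  rewrite -mulrBr normrM ger0_norm ?invr_ge0// ler_piMr ?invr_ge0//.
  pose F k := box_average n s (fun z => g (z + b *+ k)).
  rewrite (eq_bigr (fun k : 'I_n => F k.+1)); last first.
    by move=> k _; congr box_average; apply/funext => z; rewrite mulrSr addrA.
  rewrite -sumrB -(big_mkord xpredT (fun k => F k.+1 - F k)) telescope_sumr//.
  have F01 k : 0 <= F k <= 1 by exact: box_average01.
  by have := F01 n; have := F01 0; rewrite ler_norml; lra.
rewrite -mulrBr normrM ger0_norm ?invr_ge0// -sumrB.
rewrite ler_pdivrMl ?ltr0n//; apply: (le_trans (ler_norm_sum _ _ _)).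
rewrite mulr_natl -[X in _ *+ X]card_ord -sumr_const ler_sum// => k _.
have := IH (fun z => g (z + b *+ k)) asn (fun z => g01 _).
by under [X in box_average _ _ X]funext => z do rewrite addrAC.
Qed.

Lemma cvg_ultra01 (T : Type) (W : set_system T) (u : T -> R) :
  UltraFilter W -> (forall t, 0 <= u t <= 1) -> exists l : R, u @ W --> l.
Proof.
move=> UW u01.
have UF : UltraFilter (u @ W) by exact: fmap_ultra.
have := @segment_compact R 0 1; rewrite compact_ultra => /(_ _ UF).
case=> [|l [_ ul]]; last by exists l; exact: ul.
by apply: (@filterE _ W) => t; rewrite /= in_itv /=; exact: u01.
Qed.

(** [mu] is the limit of box averages of indicators along an ultrafilter for which [s] eventually
    contains any given element and [n] tends to infinity. *)
Lemma invariant_mean : exists mu : set A -> R, [/\ mu setT = 1,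
  (forall B, 0 <= mu B),
  (forall B C, B `&` C = set0 -> mu (B `|` C) = mu B + mu C) &
  (forall x B, mu [set y | B (y - x)] = mu B)].
Proof.
pose F : set_system (seq A * nat) := [set P | exists s n,
   [set p : seq A * nat | {subset s <= p.1} /\ (n < p.2)%N] `<=` P].
have FF : ProperFilter F.
  split.
    by move=> [s [n h]]; apply: (h (s, n.+1)); split=> /=.
  split.
  - by exists [::], 0%N.
  - move=> P Q [s [n sP]] [s' [n' sQ]]; exists (s ++ s'), (maxn n n').
    move=> p /= [ps pn]; split.
      apply: sP; split; last by lia.
      by move=> x xs; apply: ps; rewrite mem_cat xs.
    apply: sQ; split; last by lia.
    by move=> x xs; apply: ps; rewrite mem_cat xs orbT.
  - by move=> P Q PQ [s [n sP]]; exists s, n; apply: subset_trans PQ.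
have [W [UW FW]] := ultraFilterLemma FF.
pose ind (B : set A) z : R := (`[< B z >])%:R.
have ind01 B z : 0 <= ind B z <= 1 by rewrite /ind; case: asbool; rewrite ?lexx ler01.
have Wpos n : W [set p | (n < p.2)%N].
  by apply: FW; exists [::], n => p [].
(* The value 0 at [n = 0] is a default: almost all pairs have [n > 0]. *)
pose u B (p : seq A * nat) := if (0 < p.2)%N then box_average p.2 p.1 (ind B) else 0.
have u01 B p : 0 <= u B p <= 1.
  rewrite /u; case: ifPn => [n0|_]; last by rewrite lexx ler01.
  exact: box_average01.
have [mu muP] : {mu : set A -> R & forall B, u B @ W --> mu B}.
  by apply: (@choice _ _ (fun B l => u B @ W --> l)) => B; exact: cvg_ultra01.
have PW : ProperFilter W by exact: ultra_proper.
have muE B l : u B @ W --> l -> mu B = l.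
  by move=> h; apply: cvg_unique (muP B) h.
exists mu; split.
- apply: muE; apply: cvg_near_cst; apply: filterS (Wpos 0%N) => p /= p0.
  rewrite /u p0 -[RHS](box_average_cst p.1 1 p0); congr box_average.
  by apply/funext => z; rewrite /ind asboolT.
- move=> B.
  have cl := @closed_cvg _ _ W PW (u B) (fun r : R => 0 <= r) (@closed_ge R 0).
  by apply: cl (muP B); apply: (@filterE _ W) => p; case/andP: (u01 B p).
- move=> B C BC0; apply: muE.
  rewrite (_ : u _ = u B \+ u C); first exact: cvgD.
  apply/funext => p; rewrite /u /=; case: ifP => _; last by rewrite addr0.
  rewrite -box_averageD; congr box_average; apply/funext => z; rewrite /ind.
  rewrite asbool_or; case: asboolP => [Bz|_]; last by rewrite add0r.
  case: asboolP => [Cz|_]; last by rewrite addr0.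
  by have : (B `&` C) z by []; rewrite BC0.
- move=> x B; apply: muE.
  rewrite (_ : u _ = u B \+ (u [set y | B (y - x)] \- u B)); last first.
    by apply/funext => p /=; rewrite subrKC.
  rewrite -[mu B]addr0; apply: cvgD => //.
  apply/cvgr0Pnorm_lt => e e0.
  have [n ne] : exists n : nat, n.+1%:R^-1 < e.
    exists (Num.bound e^-1); rewrite invf_plt ?posrE//.
    apply: lt_le_trans (archi_boundP _) _; first by rewrite invr_ge0 ltW.
    by rewrite ler_nat.
  have : W [set p : seq A * nat | (- x \in p.1) /\ (n < p.2)%N].
    by apply: FW; exists [:: - x], n => p [sp pn]; split=> //; apply: sp; rewrite inE.
  apply: filterS => p [xp np] /=; apply: le_lt_trans ne; rewrite /u.
  have p0 : (0 < p.2)%N by lia.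
  rewrite p0; apply: le_trans (box_average_shift p0 xp (ind01 B)) _.
  by rewrite lef_pV2 ?posrE ?ltr0n// ler_nat.
Qed.
End InvariantMean.

(** * Bogolyubov-Folner chains *)

Definition covered (A : zmodType) (P W : set A) :=
  exists s : seq A, forall a, P a -> exists2 f, f \in s & W (a - f).

Definition opp_closed_set (A : zmodType) (S : set A) :=
  forall x, S x -> S (- x).

Fixpoint nsum (A : zmodType) (E : set A) (n : nat) : set A :=
  if n is n'.+1 then [set z | exists x y, [/\ E x, nsum E n' y & z = x + y]]
  else [set 0].

Lemma nsumD (A : zmodType) (E : set A) m n x y :
  nsum E m x -> nsum E n y -> nsum E (m + n)%N (x + y).
Proof.
elim: m x => [|m IH] x /=; first by move=> -> ny; rewrite add0r add0n.
move=> [a [b [Ea mb ->]]] ny.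
by exists a, (b + y); split=> //; [exact: IH|rewrite addrA].
Qed.

Lemma nsum0 (A : zmodType) (E : set A) n : E 0 -> nsum E n 0.
Proof.
by move=> E0; elim: n => //= n IH; exists 0, 0; rewrite addr0.
Qed.

Lemma nsumN (A : zmodType) (E : set A) n : opp_closed_set E -> opp_closed_set (nsum E n).
Proof.
move=> EN; elim: n => [|n IH] x /=; first by move=> ->; rewrite oppr0.
move=> [a [b [Ea nb ->]]]; exists (- a), (- b).
by split; [exact: EN|exact: IH|rewrite opprD].
Qed.

Lemma nsum_sub1 (A : zmodType) (E : set A) n : E 0 -> E `<=` nsum E n.+1.
Proof.
by move=> E0 x Ex; exists x, 0; split=> //; [exact: nsum0|rewrite addr0].
Qed.

Lemma covered_sub (A : zmodType) (P W W' : set A) :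
  W `<=` W' -> covered P W -> covered P W'.
Proof. by move=> WW' [s sP]; exists s => a /sP[f fs /WW']; exists f. Qed.

Lemma not_covered_seq (A : zmodType) (S : set A) : ~ covered setT S ->
  forall n, exists x : nat -> A, forall i j, (i < j < n)%N -> ~ S (x j - x i).
Proof.
move=> nS; elim=> [|n [x xP]]; first by exists (fun=> 0) => i j; rewrite ltn0 andbF.
have [y yP] : exists y, forall f, f \in [seq x i | i <- iota 0 n] -> ~ S (y - f).
  apply: contrapT => nex; apply: nS; exists [seq x i | i <- iota 0 n] => a _.
  apply: contrapT => na; apply: nex; exists a => f fs Saf.
  by apply: na; exists f.
exists (fun i => if (i < n)%N then x i else y) => i j /andP[ij jn].
case: ifPn => jn'.
  by rewrite (ltn_trans ij jn'); apply: xP; rewrite ij.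
have -> : (i < n)%N by lia.
by apply: yP; apply: map_f; rewrite mem_iota; lia.
Qed.

Section Bogolyubov.
Variables (R : realType) (A : zmodType) (mu : set A -> R).
Hypotheses (muT : mu setT = 1) (mu_ge0 : forall B, 0 <= mu B).
Hypothesis muU : forall B C, B `&` C = set0 -> mu (B `|` C) = mu B + mu C.
Hypothesis mu_shift : forall x B, mu [set y | B (y - x)] = mu B.

Let muD B C : mu B = mu (B `&` C) + mu (B `\` C).
Proof.
by rewrite -muU ?setUIDK//; apply/seteqP; split=> x // [[_ ?] [_]].
Qed.

Let mu_le B C : B `<=` C -> mu B <= mu C.
Proof.
by move=> BC; rewrite (muD C B) setIC (setIidl BC) lerDl.
Qed.

Let muUle B C : mu (B `|` C) <= mu B + mu C.
Proof.
rewrite (muD _ B) setUK setDUl setDv set0U lerD2l.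
by apply: mu_le => x [].
Qed.

Let mu0 : mu set0 = 0.
Proof. by have := muU (set0I (@set0 A)); rewrite setU0; lra. Qed.

Let mu_bigU (P : nat -> set A) (c : R) n : (forall i, (i < n)%N -> mu (P i) <= c) ->
  mu (\bigcup_(i < n) P i) <= n%:R * c.
Proof.
elim: n => [|n IH] Pc; first by rewrite II0 bigcup_set0 mu0 mul0r.
rewrite IIS bigcup_setU bigcup_set1; apply: le_trans (muUle _ _) _.
rewrite -natr1 mulrDl mul1r lerD//; last exact: Pc.
by apply: IH => i /ltnW; exact: Pc.
Qed.

Lemma covered_mu (E : set A) :
  covered setT E -> exists2 n : nat, (0 < n)%N & n%:R^-1 <= mu E.
Proof.
move=> [s sP]; have : 1 <= (size s)%:R * mu E.
  rewrite -[leLHS]muT.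
  apply: (le_trans _ (@mu_bigU (fun i => [set y | E (y - s`_i)]) _ _ _)).
    apply: mu_le => a _; have [f fs Ea] := sP a I.
    exists (index f s); first by rewrite /= index_mem.
    by rewrite /= nth_index.
  by move=> i _; rewrite mu_shift.
case: (size s) => [|n]; first by rewrite mul0r ler10.
by exists n.+1 => //; rewrite -[leLHS]mulr1 ler_pdivrMl// ltr0n.
Qed.

(** Otherwise [2t + 1] translates of [B] would have pairwise overlaps of measure at most
    [1/(2t(2t + 1))], and their union would have measure at least [1 + 1/t]. *)
Lemma mu_recurrence (B : set A) (t : nat) : (0 < t)%N -> t%:R^-1 <= mu B ->
  covered setT
    [set x | (2 * t * (2 * t).+1)%:R^-1 <= mu (B `&` [set y | B (y - x)])].
Proof.
move=> t0 Bt; set c : R := _%:R^-1; apply: contrapT => /not_covered_seq.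
move=> /(_ (2 * t).+1)[x xP].
pose P i := [set y | B (y - x i)].
have mP i : t%:R^-1 <= mu (P i) by rewrite mu_shift.
have small i j : (i < j < (2 * t).+1)%N -> mu (P j `&` P i) <= c.
  move=> /xP /= /negP; rewrite -ltNge => /ltW; apply: le_trans.
  rewrite -[leRHS](mu_shift (x i)); apply: mu_le => y /= [Pj Pi]; split=> //.
  by rewrite opprB addrA subrK.
have grow n : (n <= (2 * t).+1)%N ->
    n%:R * (t%:R^-1 - (2 * t)%:R * c) <= mu (\bigcup_(i < n) P i).
  elim: n => [|n IH] nt; first by rewrite mul0r.
  rewrite IIS bigcup_setU bigcup_set1 (muD _ (\bigcup_(i < n) P i)).
  rewrite setUK setDUl setDv set0U.
  have := muD (P n) (\bigcup_(i < n) P i); have := IH (ltnW nt).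
  have : mu (P n `&` \bigcup_(i < n) P i) <= n%:R * c.
    rewrite setI_bigcupr; apply: mu_bigU => i ni; apply: small.
    by rewrite ni.
  have : n%:R * c <= (2 * t)%:R * c.
    by rewrite ler_wpM2r ?invr_ge0// ler_nat; lia.
  by have := mP n; rewrite -natr1; lra.
have := grow _ (leqnn _); have : mu (\bigcup_(i < (2 * t).+1) P i) <= 1.
  by rewrite -muT; exact: mu_le.
move=> le1 /le_trans/(_ le1); rewrite mulrBr.
have t0' : (0 : R) < t%:R by rewrite ltr0n.
have -> : (2 * t).+1%:R * ((2 * t)%:R * c) = 1.
  rewrite mulrA -natrM mulnC divff// pnatr_eq0 muln_eq0; lia.
have -> : (2 * t).+1%:R / t%:R = 2 + t%:R^-1 :> R.
  by rewrite -natr1 mulrDl mul1r natrM -mulrA divff ?gt_eqF// mulr1.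
by have := t0'; rewrite -invr_gt0; lra.
Qed.

(* Sanders: if [B] nearly minimises [mu (B + E)] among the subsets of [E] of
   measure at least [1/t'], the translations that make [B] recur keep [B + E]
   almost invariant, hence so do sums of boundedly many of them. *)
Lemma syndetic_sum8 (E : set A) : E 0 -> opp_closed_set E -> covered setT E ->
  exists S : set A, [/\ S 0, opp_closed_set S, covered setT S &
    nsum S 8 `<=` nsum E 4].
Proof.
move=> E0 EN Ecov; have [t t0 Et] := covered_mu Ecov.
(* The factor 9 ensures [8/M < 1/t <= mu E], used at the end for sums of 8 elements. *)
pose M := (9 * t)%N; have M0 : (0 : R) < M%:R by rewrite ltr0n muln_gt0.
pose BE B := [set z | exists x y, [/\ B x, E y & z = x + y]].
have muE_BE B n : (0 < n)%N -> n%:R^-1 <= mu B -> mu E <= mu (BE B).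
  move=> n0 Bn; have [b Bb] : exists b, B b.
    apply: contrapT => nB; move: Bn; rewrite (_ : B = set0) ?mu0.
      by rewrite invr_le0 lern0; lia.
    by rewrite -subset0 => b Bb; apply: nB; exists b.
  rewrite -(mu_shift b); apply: mu_le => y Ey; exists b, (y - b).
  by split=> //; rewrite subrKC.
(* Descent on [l], from [l = M], where [mu <= 1] suffices: a [B] with smaller [mu (BE B)] lowers [l]
   and raises [t'], and [l = 0] contradicts [mu (BE B) >= 1/t]. *)
suff main l t' : (0 < t')%N -> (exists B : set A, [/\ B `<=` E, t'%:R^-1 <= mu B &
    mu (BE B) <= l%:R / M%:R]) ->
  exists S : set A, [/\ S 0, opp_closed_set S, covered setT S &
    nsum S 8 `<=` nsum E 4].
  apply: (main M t t0); exists E; split=> //.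
  by rewrite divff ?gt_eqF// -muT; exact: mu_le.
elim: l t' => [|l IH] t' t'0 [B [BE_ Bt Bl]].
  have := muE_BE _ _ t'0 Bt.
  have : (0 : R) < t%:R^-1 by rewrite invr_gt0 ltr0n.
  by move: Bl; rewrite mul0r; lra.
pose T := (2 * t' * (2 * t').+1)%N.
have T0 : (0 < T)%N by rewrite !muln_gt0 t'0.
have [ex|nex] := pselect (exists B : set A, [/\ B `<=` E, T%:R^-1 <= mu B &
    mu (BE B) <= l%:R / M%:R]).
  exact: IH ex.
pose sh x (P : set A) := [set y | P (y - x)].
pose S := [set x | T%:R^-1 <= mu (B `&` sh x B)].
pose P := BE B.
pose D x := mu (P `\` sh x P).
have DS x : S x -> D x < M%:R^-1.
  move=> Sx; have lt : l%:R / M%:R < mu (P `&` sh x P).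
    rewrite ltNge; apply/negP => le; apply: nex; exists (B `&` sh x B).
    split=> //; first by move=> y [/BE_].
    apply: le_trans le; apply: mu_le => _ [y [z [[By Bxy] Ez ->]]].
    split; first by exists y, z.
    by exists (y - x), z; split=> //; rewrite addrAC.
  have := muD P (sh x P); rewrite -/(D x); move: Bl lt.
  by rewrite -/P -natr1 mulrDl mul1r; lra.
have Dadd x y : D (x + y) <= D x + D y.
  rewrite -[D y](mu_shift x); apply: le_trans (muUle _ _).
  apply: mu_le => z [Pz nPz]; have [Pzx|nPzx] := pselect (sh x P z); last by left.
  by right; split=> // Pzxy; apply: nPz; rewrite /sh /= opprD addrA.
have DnS n z : nsum S n z -> D z <= n%:R / M%:R.
  elim: n z => [|n IHn] z /=.
    move=> ->; rewrite mul0r /D (_ : _ `\` _ = set0) ?mu0//.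
    by rewrite -subset0 => y [Py]; rewrite /sh /= subr0.
  move=> [x [y [/DS Dx /IHn Dy ->]]]; have := Dadd x y.
  by rewrite -natr1 mulrDl mul1r; lra.
exists S; split.
- rewrite /S /= (_ : sh 0 B = B); last by apply/funext => y; rewrite /sh /= subr0.
  rewrite setIid; apply: le_trans Bt; rewrite lef_pV2 ?posrE ?ltr0n// ler_nat /T.
  by lia.
- move=> x; rewrite /S /= -(mu_shift (- x)) => /le_trans; apply; apply: mu_le.
  by move=> y; rewrite /sh /= opprK addrK => -[].
- exact: mu_recurrence.
- move=> z /DnS Dz.
  (* As [D z < mu P], the set [P = B + E] meets its translate by [z], so [z] is a difference of two
     elements of [P] and lies in [4E]. *)
  have [y [Py Pyz]] : exists y, P y /\ sh z P y.
    apply: contrapT => ny; have : D z = mu P.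
      congr mu; apply/seteqP; split=> [y []//|y Py]; split=> // Pyz.
      by apply: ny; exists y.
    have := muE_BE _ _ t'0 Bt; rewrite -/P.
    have : (8%:R / M%:R : R) < t%:R^-1.
      rewrite ltr_pdivrMr// /M natrM mulrCA mulVf ?pnatr_eq0 -?lt0n// mulr1.
      by rewrite ltr_nat.
    by move: Dz; lra.
  case: Py => [b [e [/BE_ Eb Ee yE]]]; case: Pyz => [b' [e' [/BE_ Eb' Ee' yzE]]].
  have -> : z = b + (e + (- b' + (- e' + 0))).
    by rewrite addr0 -opprD -yzE yE opprB addrA addrCA subrr addr0.
  exists b, (e + (- b' + (- e' + 0))); split=> //.
  exists e, (- b' + (- e' + 0)); split=> //.
  exists (- b'), (- e' + 0); split=> //; first exact: EN.
  by exists (- e'), 0; split=> //; exact: EN.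
Qed.
End Bogolyubov.

(** A countable base at 0 of a totally bounded group topology, possibly not Hausdorff. *)
Definition bohr_chain (A : zmodType) (V : nat -> set A) := [/\
  forall j, V j 0,
  forall j, opp_closed_set (V j),
  forall j x y, V j.+1 x -> V j.+1 y -> V j (x + y) &
  forall j, covered setT (V j)].

(** Iterating [syndetic_sum8] gives sets [S j] with [8 S_(j+1)] inside [4 S_j], so the sets [4 S_j]
    form a chain. *)
Lemma bohr_chain_nsum4 (A : zmodType) (E : set A) :
  E 0 -> opp_closed_set E -> covered setT E ->
  exists2 V, bohr_chain V & V 0%N `<=` nsum E 4.
Proof.
move=> E0 EN Ecov.
have [mu [muT mu_ge0 muU mu_shift]] := invariant_mean Rdefinitions.R A.
pose good (S : set A) := [/\ S 0, opp_closed_set S & covered setT S].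
have [step stepP] : {step : set A -> set A & forall S, good S ->
    good (step S) /\ nsum (step S) 8 `<=` nsum S 4}.
  apply: (@choice _ _ (fun S S' => good S ->
    good S' /\ nsum S' 8 `<=` nsum S 4)) => S.
  have [gS|] := pselect (good S); last by exists setT.
  have [S0 SN Scov] := gS.
  have [S' [S'0 S'N S'cov SS']] := syndetic_sum8 muT mu_ge0 muU mu_shift S0 SN Scov.
  by exists S'.
pose S j := iter j step E.
have goodS j : good (S j) by elim: j => [//|j IH] /=; case: (stepP _ IH).
exists (fun j => nsum (S j) 4); last by [].
split=> j.
- by apply: nsum0; case: (goodS j).
- by apply: nsumN; case: (goodS j).
- move=> x y Sx Sy; have [_] := stepP _ (goodS j); apply.
  exact: (nsumD (m := 4) (n := 4)).
- case: (goodS j) => S0 _; apply: covered_sub; exact: nsum_sub1.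
Qed.

(** * Rigid integers and generic sequences *)

Definition sumset (A : zmodType) (P Q : set A) : set A :=
  [set z | exists x y, [/\ P x, Q y & z = x + y]].

Definition multiples (A : zmodType) (n : nat) : set A := range (fun x : A => x *+ n).
Arguments multiples : clear implicits.

Lemma covered_sumset (A : zmodType) (P W Q W' : set A) :
  covered P (sumset W Q) -> covered Q W' -> covered P (sumset W W').
Proof.
move=> [s sP] [s' s'Q]; exists [seq x + y | x <- s, y <- s'] => a /sP[f fs].
move=> [w [z [Ww /s'Q[f' f's' Wz] afE]]]; exists (f + f'); first exact: allpairs_f.
by exists w, (z - f'); split=> //; rewrite opprD addrA afE addrA.
Qed.

Section SmallNeighbourhoods.
Variable X : topologicalZmodType.
Implicit Types U V W : set X.

Lemma nbhs0_opp U : nbhs (0 : X) U -> nbhs (0 : X) [set x | U (- x)].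
Proof. by move=> U0; apply: (@opp_continuous X 0); rewrite /= oppr0. Qed.

Lemma nbhs0_split U : nbhs (0 : X) U -> exists V, [/\ nbhs (0 : X) V,
  opp_closed_set V & forall x y, V x -> V y -> U (x + y)].
Proof.
move=> U0; have := @add_continuous X (0, 0); rewrite /continuous_at /= addr0.
move=> /(_ U U0) [[V W] /= [V0 W0] VWU].
pose S := V `&` W; have S0 : nbhs (0 : X) S by exact: filterI.
exists (S `&` [set x | S (- x)]); split.
- by apply: filterI => //; exact: nbhs0_opp.
- by move=> x [Sx Snx]; split=> //=; rewrite opprK.
- by move=> x y [[Vx _] _] [[_ Wy] _]; exact: (VWU (x, y)).
Qed.

Lemma nbhs0_setC1 (a : X) : hausdorff_space X -> a != 0 -> nbhs (0 : X) (~` [set a]).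
Proof.
move=> hX a0; apply: open_nbhs_nbhs; split.
  apply: closed_openC; apply: accessible_closed_set1.
  exact: hausdorff_accessible.
by move=> /= a00; move: a0; rewrite -a00 eqxx.
Qed.

Lemma nbhs0_mulrn U n : nbhs (0 : X) U ->
  nbhs (0 : X) [set x | forall a, (a <= n)%N -> U (x *+ a)].
Proof.
elim: n U => [|n IH] U U0.
  apply: filterS filterT => x _ a; rewrite leqn0 => /eqP ->.
  exact: nbhs_singleton U0.
have [V [V0 _ VU]] := nbhs0_split U0.
apply: filterS (filterI V0 (IH _ V0)) => x [Vx Vxn] [|a] an.
  exact: nbhs_singleton U0.
by rewrite mulrS; apply: VU => //; exact: Vxn.
Qed.

(* For [q = 0] every [d > 0] is a proper divisor. *)
Definition rigid q := exists2 W, nbhs (0 : X) W & forall d, (0 < d)%N ->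
  (d %| q)%N -> d != q -> ~ covered (multiples X d) (sumset W (multiples X q)).

(** If 0 is rigid, it serves, as [0X] is trivial. Otherwise some [nX] with [n > 0] is covered by
    translates of [V]. The least divisor [q] of [n] with [qX] precompact modulo [nX] is then rigid,
    because coverings modulo [qX] compose with those modulo [nX]. *)
Lemma rigid_covered U : nbhs (0 : X) U ->
  exists2 q, rigid q & covered (multiples X q) U.
Proof.
move=> U0; have [r0|nr0] := pselect (rigid 0).
  exists 0%N => //; exists [:: 0] => _ [x _ <-]; exists 0; rewrite ?inE//.
  by rewrite mulr0n subrr; exact: nbhs_singleton U0.
have [V [V0 _ VU]] := nbhs0_split U0.
have sum0 W : sumset W (multiples X 0) `<=` W.
  by move=> _ [w [_ [Ww [x _ <-] ->]]]; rewrite mulr0n addr0.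
have [n [n0 nV]] : exists n, (0 < n)%N /\ covered (multiples X n) V.
  apply: contrapT => nex; apply: nr0; exists V => // d d0 _ _ cov.
  by apply: nex; exists d; split=> //; exact: covered_sub cov.
pose D d := [/\ (0 < d)%N, (d %| n)%N &
  forall V', nbhs (0 : X) V' -> covered (multiples X d) (sumset V' (multiples X n))].
have Dn : D n.
  split=> // V' V'0; exists [:: 0] => a na; exists 0; rewrite ?inE// subr0.
  by exists 0, a; rewrite add0r; split=> //; exact: nbhs_singleton V'0.
have exD : exists d, `[< D d >] by exists n; exact/asboolP.
case: (ex_minnP exD) => q /asboolP[q0 qn qV] qmin.
exists q; last first.
  apply: covered_sub (covered_sumset (qV _ V0) nV).
  by move=> _ [x [y [Vx Vy ->]]]; exact: VU.
have /choice[W WP] (d : 'I_q) : exists W, nbhs (0 : X) W /\ ((0 < d)%N -> (d %| q)%N ->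
    ~ covered (multiples X d) (sumset W (multiples X n))).
  have [[d0 dq]|nd] := pselect ((0 < d)%N /\ (d %| q)%N); last first.
    by exists setT; split=> [|d0 dq]; [exact: filterT|case: nd].
  apply: contrapT => nex; suff /qmin : `[< D d >] by have := ltn_ord d; lia.
  apply/asboolP; split=> //; first exact: dvdn_trans dq qn.
  by move=> V' V'0; apply: contrapT => nc; apply: nex; exists V'.
have /nbhs0_split[W' [W'0 _ W'W]] : nbhs (0 : X) [set x | forall d : 'I_q, W d x].
  by apply: filter_forall => d; case: (WP d).
exists W' => // d d0 dq d_neq_q cov.
have dltq : (d < q)%N by rewrite ltn_neqAle d_neq_q dvdn_leq.
have [_ /(_ d0 dq)] := WP (Ordinal dltq); apply => /=.
have := covered_sumset cov (qV _ W'0); apply: covered_sub.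
move=> _ [w [_ [W'w [w' [z [W'w' nz ->]]] ->]]].
exists (w + w'), z; split=> //; last by rewrite addrA.
exact: W'W.
Qed.

Lemma rigid_neq1 : (exists2 U, nbhs (0 : X) U & ~ covered setT U) ->
  exists2 q, rigid q & q != 1%N.
Proof.
move=> [U /rigid_covered[q rq qU] nU]; exists q => //; apply/eqP => q1; apply: nU.
move: qU; rewrite q1 => -[s sP]; exists s => x _; apply: sP.
by exists x.
Qed.
End SmallNeighbourhoods.
Arguments rigid : clear implicits.

(* The idea is B. H. Neumann's: if [t *+ d] avoids [F - F + W - W], then [x] and
   [x + t] cannot both violate the constraint [(d, W, F)]. *)
Lemma exists_avoiding (A : zmodType) (T : eqType) (l : seq T) (d : T -> nat)
    (W : T -> set A) (F : T -> seq A) :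
  (forall i, i \in l ->
     ~ covered (multiples A (d i)) [set u - v | u in W i & v in W i]) ->
  exists x, forall i, i \in l -> forall f, f \in F i -> ~ W i (x *+ d i - f).
Proof.
elim: l F => [|i l IH] F hl; first by exists 0.
have [t tP] : exists t, forall f f', f \in F i -> f' \in F i ->
    ~ [set u - v | u in W i & v in W i] (t *+ d i - (f - f')).
  apply: contrapT => nex; apply: (hl i (mem_head _ _)).
  exists [seq f - f' | f <- F i, f' <- F i] => _ [t _ <-]; apply: contrapT => nt.
  apply: nex; exists t => f f' fF f'F Wt; apply: nt.
  by exists (f - f') => //; exact: allpairs_f.
have [|x xP] := IH (fun j => F j ++ [seq f - t *+ d j | f <- F j]).
  by move=> j jl; apply: hl; rewrite inE jl orbT.
have xl j : j \in l -> forall f, f \in F j ->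
    ~ W j (x *+ d j - f) /\ ~ W j ((x + t) *+ d j - f).
  move=> jl f fF; split; first by apply: xP; rewrite // mem_cat fF.
  rewrite mulrnDl -addrA -[t *+ _ - f]opprB; apply: xP => //.
  by rewrite mem_cat; apply/orP; right; apply: map_f.
have [ok|bad] := pselect (forall f, f \in F i -> ~ W i (x *+ d i - f)).
  by exists x => j; rewrite inE => /orP[/eqP->//|jl] f fF; case: (xl j jl f fF).
exists (x + t) => j; rewrite inE => /orP[/eqP->|jl] f fF; last by case: (xl j jl f fF).
move=> Wxt; apply: bad => f' f'F Wx; apply: (tP f f') => //.
exists ((x + t) *+ d i - f) => //; exists (x *+ d i - f') => //.
rewrite mulrnDl [x *+ d i + t *+ d i]addrC -!addrA !opprB; congr (_ + _).
by rewrite [- f + _]addrC addrA subrKC.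
Qed.

(** The Bezout multiplier is reduced modulo [q]; the bound [q + 1] also allows [q = 0], where [a] is
    the sign of [c]. *)
Lemma bezoutz_bounded (c : int) (q : nat) :
  exists a b : int, a * c = (gcdn `|c| q)%:Z + b * q%:Z /\ (`|a| <= q.+1)%N.
Proof.
have [->|q0] := posnP q.
  exists (Num.sg c), 0; rewrite gcdn0 mul0r addr0; split.
    by rewrite -normrEsg abszE.
  by rewrite absz_sg; case: (c != 0).
have [u [v uv]] : exists u v : int, u * c + v * q%:Z = (gcdn `|c| q)%:Z.
  by have [u [v uv]] := Bezoutz c q%:Z; exists u, v; rewrite uv.
exists (u %% q)%Z, (- v - (u %/ q)%Z * c); split.
  by rewrite -uv; move: (divz_eq u q); move: (u %/ q)%Z (u %% q)%Z => k r ->; ring.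
have := ltz_pmod u (q0 : (0 < q%:Z)); have := modz_ge0 u (lt0r_neq0 (q0 : (0 < q%:Z))).
by lia.
Qed.

Lemma sequence_choice (T : Type) (t0 : T) (P : nat -> (nat -> T) -> T -> Prop) :
  (forall k g g' y, (forall i, (i < k)%N -> g i = g' i) -> P k g y -> P k g' y) ->
  (forall k g, exists y, P k g y) -> exists x, forall k, P k x (x k).
Proof.
move=> Pext Pex.
have [step stepP] : {step : nat * (nat -> T) -> T & forall p, P p.1 p.2 (step p)}.
  by apply: (@choice _ _ (fun p y => P p.1 p.2 y)) => p.
pose fix prefix k : nat -> T := if k is k'.+1 then
  (fun i => if (i < k')%N then prefix k' i else step (k', prefix k')) else (fun=> t0).
have prefixS k i : prefix k.+1 i =
  if (i < k)%N then prefix k i else step (k, prefix k) by [].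
have prefixE k i : (i < k)%N -> prefix k i = prefix i.+1 i.
  elim: k => [//|k IH]; rewrite ltnS leq_eqVlt => /orP[/eqP->//|ik].
  by rewrite prefixS ik IH.
exists (fun k => prefix k.+1 k) => k; rewrite prefixS ltnn.
by apply: Pext (stepP (k, prefix k)) => i; exact: prefixE.
Qed.

(** * Integer combinations of a sequence *)

Section Evaluation.
Variables (A : zmodType) (x : nat -> A).
Implicit Types c d : {poly int}.

(* Finitely supported integer sequences are encoded as polynomials [c], so that
   the sum of the coefficients is [c.[1]]. *)
Definition lincomb c : A := \sum_(i < size c) x i *~ c`_i.

Lemma lincombE n c : (size c <= n)%N -> lincomb c = \sum_(i < n) x i *~ c`_i.
Proof.
move=> cn; rewrite /lincomb (big_ord_widen n (fun i => x i *~ c`_i) cn).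
rewrite big_mkcond; apply: eq_bigr => i _; case: ltnP => // ci.
by rewrite nth_default// mulr0z.
Qed.

Lemma lincombD c d : lincomb (c + d) = lincomb c + lincomb d.
Proof.
have s1 := size_polyD c d; set n := maxn _ _ in s1.
rewrite (lincombE s1) (lincombE (leq_maxl _ _ : size c <= n)%N).
rewrite (lincombE (leq_maxr _ _ : size d <= n)%N) -big_split.
by apply: eq_bigr => i _; rewrite coefD mulrzDr.
Qed.

Lemma lincombN c : lincomb (- c) = - lincomb c.
Proof.
rewrite /lincomb size_polyN -sumrN; apply: eq_bigr => i _.
by rewrite coefN mulrNz.
Qed.

Lemma lincombMn c n : lincomb (c *+ n) = lincomb c *+ n.
Proof.
elim: n => [|n IH]; last by rewrite !mulrS lincombD IH.
by rewrite !mulr0n /lincomb size_poly0 big_ord0.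
Qed.

Lemma lincombMz c (n : int) : lincomb (c *~ n) = lincomb c *~ n.
Proof.
by case: n => n; rewrite ?NegzE ?mulrNz ?lincombN -?pmulrn lincombMn.
Qed.

Lemma lincombXn i : lincomb 'X^i = x i.
Proof.
rewrite /lincomb size_polyXn big_ord_recr /= coefXn eqxx big1 ?add0r// => j _.
by rewrite coefXn (ltn_eqF (ltn_ord j)) mulr0z.
Qed.

(* The sets [tame m] are neighbourhoods of [0] for a group topology on
   [{poly int}] in which ['X^i] tends to [0]. *)
Definition tame m c := forall i, (`|(c`_i)%R| * 2 ^ m <= i)%N.

End Evaluation.

Lemma tame_le m c i : tame m c -> (`|(c`_i)%R| <= i)%N.
Proof. by move=> cm; apply: leq_trans (cm i); rewrite leq_pmulr// expn_gt0. Qed.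

Definition separated (X : topologicalZmodType) (x : nat -> X) (q : nat) :=
  exists U m, nbhs (0 : X) U /\ forall c, tame m c -> U (lincomb x c) ->
    forall i, (q %| c`_i)%Z.

(** * Construction of a generic sequence *)

Section SeparatedSequence.
Variable X : topologicalZmodType.

(** The bound [(k + 1)^2] allows the product of a Bezout multiplier, at most [q + 1], and a tame
    coefficient, at most [k]. *)
Let separating (W : nat -> set X) k (g : nat -> X) (y : X) :=
  forall q d, (q <= k)%N -> rigid X q -> (0 < d <= k)%N -> (d %| q)%N -> d != q ->
  forall e : nat -> int, (forall i, (i < k)%N -> (`|e i| <= k.+1 ^ 2)%N) ->
  ~ sumset (W q) (multiples X q) (y *+ d - \sum_(i < k) g i *~ e i).

Let separating_ex (W : nat -> set X) k g :
  (forall q, rigid X q -> forall d, (0 < d)%N -> (d %| q)%N -> d != q ->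
    ~ covered (multiples X d) [set u - v | u in sumset (W q) (multiples X q)
                                         & v in sumset (W q) (multiples X q)]) ->
  exists y, separating W k g y.
Proof.
move=> hW.
pose l := [seq p <- [seq (q, d) | q <- iota 0 k.+1, d <- iota 1 k] |
  `[< rigid X p.1 >] && ((p.2 %| p.1)%N && (p.2 != p.1))].
have lE q d : ((q, d) \in l) = [&& `[< rigid X q >], (d %| q)%N, d != q,
    (q <= k)%N & (0 < d <= k)%N].
  suff memE : ((q, d) \in [seq (q, d) | q <- iota 0 k.+1, d <- iota 1 k]) =
      ((q <= k)%N && (0 < d <= k)%N) by rewrite mem_filter memE -!andbA.
  apply/idP/idP => [/allpairsPdep[q' [d' []]]|qdk].
    by rewrite !mem_iota => ? ? [-> ->]; lia.
  by apply/allpairsPdep; exists q, d; rewrite !mem_iota; split=> //; lia.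
pose B := (k.+1 ^ 2)%N.
(* The finitely many combinations with coefficients in [[-B, B]], each shifted by [B] to index it by
   an ordinal. *)
pose F := [seq \sum_(i < k) g i *~ ((f i : nat)%:Z - B%:Z) |
  f : {ffun 'I_k -> 'I_(2 * B).+1}].
have [|y yP] := @exists_avoiding X _ l snd (fun p => sumset (W p.1) (multiples X p.1))
    (fun=> F).
  by move=> [q d]; rewrite lE => /and5P[/asboolP rq dq dnq _ /andP[d0 _]]; exact: hW.
exists y => q d qk rq /andP[d0 dk] dq dnq e eP.
apply: (yP (q, d)); first by rewrite lE dq dnq qk d0 dk asboolT.
rewrite /F; apply/mapP; exists [ffun i : 'I_k => inord `|(e i + B%:Z)%R|%N].
  by rewrite mem_enum.
apply: eq_bigr => i _; congr (_ *~ _); rewrite ffunE inordK.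
  by have := eP i (ltn_ord i); rewrite -/B; lia.
by have := eP i (ltn_ord i); rewrite -/B; lia.
Qed.

(** Let [k] be the last index with [q] not dividing [c_k]. Modulo [qX] the later terms vanish, and a
    Bezout multiplier turns [c_k] into [d = gcd(c_k, q)], a proper divisor of [q]. Then [x_k *+ d]
    is close to a combination of earlier terms, which the choice of [x_k] excludes. *)
Lemma exists_separated : exists x : nat -> X, forall q, rigid X q -> separated x q.
Proof.
have [W WP] : {W : nat -> set X & forall q, [/\ nbhs (0 : X) (W q), opp_closed_set (W q) &
    rigid X q -> forall d, (0 < d)%N -> (d %| q)%N -> d != q ->
    ~ covered (multiples X d) [set u - v | u in sumset (W q) (multiples X q)
                                         & v in sumset (W q) (multiples X q)]]}.
  apply: (@choice _ _ (fun q W => [/\ nbhs (0 : X) W, opp_closed_set W &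
    rigid X q -> forall d, (0 < d)%N -> (d %| q)%N -> d != q ->
    ~ covered (multiples X d) [set u - v | u in sumset W (multiples X q)
                                         & v in sumset W (multiples X q)]])) => q.
  have [[W W0 Wq]|nr] := pselect (rigid X q); last first.
    by exists setT; split=> //; exact: filterT.
  have [V [V0 VN VW]] := nbhs0_split W0; exists V; split=> // _ d d0 dq dnq.
  move=> cov; apply: (Wq d d0 dq dnq); apply: covered_sub cov.
  move=> _ [_ [v [_ [Vv [z _ <-] ->]]]] [_ [v' [_ [Vv' [z' _ <-] ->]]] <-].
  exists (v - v'), ((z - z') *+ q); split; first by apply: VW => //; exact: VN.
    by exists (z - z').
  by rewrite mulrnBl opprD addrACA.
have [|k g|x xP] := @sequence_choice X 0 (separating W).
- move=> k g g' y gg' h q d qk rq dk dq dnq e eP.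
  by under eq_bigr => i _ do rewrite -gg'//; exact: h.
- by apply: separating_ex => q; case: (WP q).
exists x => q rq; have [Wq0 WqN _] := WP q.
(* Multiples up to [q + 1] leave room for the Bezout multiplier; with [m = q], nonzero coefficients
   occur only at indices [k >= 2^q > q], where the constraints for [q] are in force. *)
exists [set u | forall a, (a <= q.+1)%N -> W q (u *+ a)], q.
split; first exact: nbhs0_mulrn.
move=> c cq Wc i; apply: contrapT => /negP nqi.
have exk : exists k, ~~ (q %| c`_k)%Z by exists i.
have bnd k : ~~ (q %| c`_k)%Z -> (k <= size c)%N.
  by apply: contraR; rewrite -ltnNge => /ltnW ck; rewrite nth_default// dvdz0.
case: (ex_maxnP exk bnd) => k nqk kmax.
have ck0 : c`_k != 0 by apply: contra nqk => /eqP->; rewrite dvdz0.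
have ck_k := tame_le k cq.
have qk : (q <= k)%N.
  by have := cq k; have := ltn_expl q (isT : 1 < 2)%N; nia.
pose d := gcdn `|(c`_k)%R|%N q.
have d0 : (0 < d)%N by rewrite gcdn_gt0 absz_gt0 ck0.
have dk : (d <= k)%N.
  by apply: leq_trans ck_k; apply: dvdn_leq (dvdn_gcdl _ _); rewrite absz_gt0.
have dnq : d != q.
  by apply: contra nqk => /eqP dq; rewrite dvdzE /= -dq dvdn_gcdl.
have [a [b [ab aq]]] := bezoutz_bounded c`_k q.
apply: (xP k q d qk rq _ (dvdn_gcdr _ _) dnq (fun i => - (a * c`_i))).
- by rewrite d0.
- move=> j jk; have cj := tame_le j cq.
  by rewrite abszN abszM expnS expn1; apply: leq_mul; lia.
pose n := maxn (size c) k.+1.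
pose Z := \sum_(k.+1 <= i < n) x i *~ (c`_i %/ q)%Z.
have cE : lincomb x c = \sum_(i < k) x i *~ c`_i + x k *~ c`_k + Z *+ q.
  rewrite (lincombE x (leq_maxl _ k.+1 : size c <= n)%N).
  rewrite -(big_mkord xpredT (fun i => x i *~ c`_i)).
  rewrite (big_cat_nat (n := k.+1))//=; last exact: leq_maxr.
  rewrite big_mkord big_ord_recr /=; congr (_ + _); rewrite -sumrMnl.
  rewrite big_nat [RHS]big_nat; apply: eq_bigr => j /andP[kj _].
  have qj : (q %| c`_j)%Z by apply: contraT => /kmax; rewrite leqNgt kj.
  by rewrite pmulrn -mulrzA divzK.
exists (lincomb x c *~ a), ((- (x k *~ b) - Z *~ a) *+ q); split.
- have := Wc _ aq; case: (a) => m /=; first by rewrite pmulrn.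
  by rewrite NegzE mulrNz -pmulrn; exact: WqN.
- by exists (- (x k *~ b) - Z *~ a).
have -> : \sum_(i < k) x i *~ - (a * c`_i) = - ((\sum_(i < k) x i *~ c`_i) *~ a).
  rewrite mulrz_suml -sumrN; apply: eq_bigr => j _.
  by rewrite mulrNz mulrC mulrzA.
have -> : x k *+ d = x k *~ c`_k *~ a - x k *~ b *+ q.
  by rewrite -mulrzA mulrC ab mulrzDr mulrzA -!pmulrn addrK.
have ZE : Z *+ q *~ a = Z *~ a *+ q by rewrite !pmulrn -!mulrzA mulrC.
rewrite cE !mulrzDl opprK mulrnBl mulNrn ZE.
rewrite [LHS]addrC addrA -!addrA; congr (_ + (_ + _)).
by rewrite addrCA subrr addr0.
Qed.
End SeparatedSequence.

(** * Group topologies defined by filters *)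

Lemma nbhs_translate (X : topologicalZmodType) (x y : X) (A : set X) :
  nbhs (y - x) A -> nbhs y [set z | A (z - x)].
Proof.
move=> yA; have c : continuous (fun z : X => z - x).
  move=> z; apply: (@continuous_comp _ _ _ (fun z => (z, - x))
    (fun p : X * X => p.1 + p.2)); last exact: add_continuous.
  by apply: cvg_pair => /=; [exact: cvg_id|exact: cvg_cst].
by have := c y A yA.
Qed.

Section FilterTopology.
Variables (X : topologicalZmodType) (NN : set_system X).
Context {NF : Filter NN}.
Hypothesis NN0 : forall N, NN N -> N 0.
Hypothesis NNB : forall N, NN N -> exists2 M, NN M & forall x y, M x -> M y -> N (x - y).

Let NNopp N : NN N -> NN [set y | N (- y)].
Proof.
move=> /NNB[M NM MN]; have M0 := NN0 NM; apply: filterS NM => y My /=.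
by rewrite -sub0r; exact: MN.
Qed.

Let op : set_system X := [set O | forall x, O x -> NN [set y | O (x + y)]].

Let opI : setI_closed op.
Proof. by move=> A B oA oB x [/oA Ax /oB Bx]; apply: filterI. Qed.

Let op_bigcup (S : set_system X) : S `<=` op -> op (\bigcup_(A in S) A).
Proof. by move=> So x [A SA Ax]; apply: filterS (So _ SA _ Ax) => y; exists A. Qed.

Definition filter_topologyOn : topologyOn X :=
  @TopologyOn X op (fun _ _ => filterT) opI op_bigcup.

Local Notation T := (retopologize filter_topologyOn).

Lemma filter_topologyOn_nbhs (x : T) (A : set T) :
  nbhs x A <-> NN [set y | A (x + y)].
Proof.
rewrite nbhsE; split=> [[O [oO Ox] OA]|NA].
  by apply: filterS (oO x Ox) => y; exact: OA.
(* The interior of [A]: the points of which [A] is to be a neighbourhood. *)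
pose O := [set z : T | NN [set y | A (z + y)]].
have oO : op O.
  move=> z /NNB[M NM MN]; have NM' := NNopp NM; apply: filterS NM => w Mw /=.
  apply: filterS NM' => y /(MN _ _ Mw).
  by rewrite /= opprK addrA.
exists O; first by split.
by move=> z /NN0 /=; rewrite addr0.
Qed.

Lemma filter_topologyOn_add : continuous (fun x : T * T => (x.1 + x.2 : T)).
Proof.
move=> [x y] A xyA; have /NNB[M NM MN] := (filter_topologyOn_nbhs _ _).1 xyA.
exists ([set z | M (z - x)], [set z | M (- (z - y))]) => /=.
  split; apply/filter_topologyOn_nbhs.
    by apply: filterS NM => z /=; rewrite addrAC subrr add0r.
  by apply: filterS (NNopp NM) => z /=; rewrite addrAC subrr add0r.
move=> [a b] /= [Ma Mb]; have := MN _ _ Ma Mb.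
by rewrite /= opprK [a - x + _]addrACA -opprD [x + y + _]addrC subrK.
Qed.

Lemma filter_topologyOn_opp : continuous (-%R : T -> T).
Proof.
move=> x A xA; have /NNopp NA := (filter_topologyOn_nbhs _ _).1 xA; apply/filter_topologyOn_nbhs.
by apply: filterS NA => y /=; rewrite opprD.
Qed.

Definition filter_topology : groupTopology X :=
  GroupTopology filter_topologyOn_add filter_topologyOn_opp.

Lemma filter_topology_hausdorff : (forall x, x != 0 -> exists2 N, NN N & ~ N x) ->
  hausdorff_space (with_topology filter_topology).
Proof.
move=> sep p q pq; apply/eqP; rewrite eq_sym -subr_eq0; apply: contrapT => /negP.
move=> /sep[N /NNB[M NM MN]]; apply.
have MS r : nbhs (r : T) [set z | M (z - r)].
  by apply/filter_topologyOn_nbhs; apply: filterS NM => z /=; rewrite addrAC subrr add0r.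
have [z [/= Mp Mq]] := pq _ _ (MS p) (MS q).
by have := MN _ _ Mp Mq; rewrite opprB addrC subrKA.
Qed.

Lemma filter_topology_weaker : NN `<=` nbhs (0 : X) ->
  opens filter_topology `<=` @open X.
Proof.
move=> Nn O oO; rewrite openE => x Ox; have := Nn _ (oO x Ox).
rewrite -(subrr x) => /nbhs_translate; apply: filterS => z /=.
by rewrite subrKC.
Qed.

Lemma filter_topology_complete : group_complete (with_topology filter_topology) ->
  forall F : set_system X, ProperFilter F ->
  (forall N, NN N -> exists x, F [set y | N (y - x)]) ->
  exists x, forall N, NN N -> F [set y | N (y - x)].
Proof.
move=> cpl F FF FC.
have [|x Fx] := cpl F FF.
  move=> E [U /filter_topologyOn_nbhs/NNB[M NM MN] UE].
  have [x Fx] := FC M NM; exists ([set y | M (y - x)], [set y | M (y - x)]) => //=.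
  move=> [a b] /= [Ma Mb]; apply: UE => /=.
  by have := MN _ _ Mb Ma; rewrite /= add0r opprB addrA subrK [- a + b]addrC.
exists x => N NM; apply: Fx; apply/filter_topologyOn_nbhs.
by apply: filterS NM => z /=; rewrite addrAC subrr add0r.
Qed.
End FilterTopology.

(** * A weaker topology with a divergent Cauchy sequence *)

Lemma ultra_covered (A : zmodType) (F : set_system A) (W : set A) :
  UltraFilter F -> covered setT W -> exists a, F [set y | W (y - a)].
Proof.
move=> UF [s sP]; have {sP} : F [set y | exists2 f, f \in s & W (y - f)].
  by apply: filterE => y; exact: sP.
elim: s => [|f s IH] Fs; first by case: (filter_ex Fs) => y [].
have [|Fn] := in_ultra_setVsetC [set y | W (y - f)] UF; first by exists f.
apply: IH; apply: filterS (filterI Fs Fn) => y [[g]].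
by rewrite inE => /orP[/eqP->//|gs Wg _]; exists g.
Qed.

(** A centre [f] need not lie in [qX], so it is replaced by a multiple of [q] in the same translate,
    at the cost of passing from [W] to [W - W]. *)
Lemma covered_preimage_mulrn (A : zmodType) (q : nat) (W W' : set A) :
  covered (multiples A q) W -> (forall u v, W u -> W v -> W' (u - v)) ->
  covered setT [set x | W' (x *+ q)].
Proof.
move=> [s sP] WW'.
have [g gP] : {g : A -> A & forall f y, W (y *+ q - f) -> W (g f *+ q - f)}.
  apply: (@choice _ _ (fun f z => forall y, W (y *+ q - f) -> W (z *+ q - f))).
  move=> f; have [[y Wy]|ny] := pselect (exists y, W (y *+ q - f)); first by exists y.
  by exists 0 => y Wy; case: ny; exists y.
exists (map g s) => x _; have [f fs Wf] := sP (x *+ q) (ex_intro2 _ _ x I erefl).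
exists (g f); first exact: map_f.
by have := WW' _ _ Wf (gP _ _ Wf); rewrite /= mulrnBl opprB addrA subrK.
Qed.

Lemma tameD m c d : tame m.+1 c -> tame m.+1 d -> tame m (c + d).
Proof.
by move=> cm dm i; have := cm i; have := dm i; rewrite coefD !expnS; lia.
Qed.

Lemma tameN m c : tame m c -> tame m (- c).
Proof. by move=> cm i; rewrite coefN abszN. Qed.

Lemma tame_leq m n c : (m <= n)%N -> tame n c -> tame m c.
Proof.
move=> mn cn i; apply: leq_trans (cn i).
by rewrite leq_mul// leq_exp2l.
Qed.

Lemma tameXn m i : (2 ^ m <= i)%N -> tame m 'X^i.
Proof.
by move=> mi j; rewrite coefXn; case: eqP => [->|_] /=; rewrite ?mul1n ?mul0n.
Qed.

Lemma tame_coef0 m (c : {poly int}) i : tame m c -> (i < 2 ^ m)%N -> c`_i = 0.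
Proof.
move=> cm im; apply/eqP; rewrite -absz_eq0; have := cm i.
by case: `|_|%N => // n; nia.
Qed.

(** * Coefficientwise domination *)

Definition dominated (d c : {poly int}) := forall i, (`|(d`_i)%R| <= `|(c`_i)%R|)%N.

Lemma dominated_split d c c' : dominated d (c + c') ->
  exists d1 d2, [/\ d = d1 + d2, dominated d1 c & dominated d2 c'].
Proof.
move=> dcc'.
(* Truncation of [m] to absolute value at most that of [n], keeping the sign; the remainder is then
   bounded by [c']. *)
pose clamp (m n : int) := if (`|m| <= `|n|)%N then m
  else if 0 <= m then `|n|%N%:Z else - (`|n|%N%:Z).
pose d1 := \poly_(i < size d) clamp d`_i c`_i.
have d1E i : d1`_i = clamp d`_i c`_i.
  rewrite coef_poly; case: ltnP => // /(nth_default 0) ->.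
  by rewrite /clamp absz0 leq0n.
exists d1, (d - d1); split=> [|i|i]; first by rewrite subrKC.
  by rewrite d1E /clamp; case: ifPn => // _; case: ifP => _; lia.
have := dcc' i; rewrite coefB coefD d1E /clamp.
move: c`_i c'`_i d`_i => u v w; case: ifPn => uw wuv; first by rewrite subrr absz0.
by case: ifPn => w0; lia.
Qed.

Lemma dominated_divide (c : {poly int}) (q : nat) : (forall i, (q %| c`_i)%Z) ->
  exists d, [/\ c = d *+ q, dominated d c & c.[1] = 0 -> d.[1] = 0].
Proof.
move=> qc; have [q0|q0] := posnP q.
  exists 0; split=> [|i|_]; rewrite ?horner0// ?coef0// q0 mulr0n.
  apply/polyP => i; rewrite coef0; have := qc i.
  by rewrite q0 dvd0z => /eqP.
pose d := \poly_(i < size c) (c`_i %/ q)%Z.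
have dE i : c`_i = d`_i *+ q.
  rewrite coef_poly; case: ltnP => [_|/(nth_default 0)->]; last by rewrite mul0rn.
  by rewrite pmulrn mulrzz divzK.
have cE : c = d *+ q by apply/polyP => i; rewrite coefMn.
exists d; split=> // [i|].
  by rewrite dE pmulrn mulrzz abszM leq_pmulr.
by rewrite {1}cE hornerMn => /eqP; rewrite mulrn_eq0 => /orP[|/eqP//]; lia.
Qed.

Section Core.
Variables (X : topologicalZmodType) (x : nat -> X) (UU : set_system nat).
Context {UUU : UltraFilter UU}.
Hypothesis UU_oo : forall n, UU [set i | (n <= i)%N].
Implicit Types (V : nat -> set X) (L : seq (nat -> set X)).
Local Notation phi := (lincomb x).

(** To see that [q] divides [c_i], compare [c] with an approximant [c'] so tame that [c'_i = 0]:
    their difference is tame with value near 0. *)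
Lemma separated_approx q a (P : set {poly int}) : separated x q ->
  (forall U m, nbhs (0 : X) U -> exists c, [/\ tame m c, P c & U (a - phi c)]) ->
  forall U, nbhs (0 : X) U ->
    exists c, [/\ P c, U (a - phi c) & forall i, (q %| c`_i)%Z].
Proof.
move=> [W [m [W0 Wdvd]]] app U U0; have [V [V0 VN VW]] := nbhs0_split W0.
have [c [cm Pc [Vc Uc]]] := app _ m.+1 (filterI V0 U0).
exists c; split=> // i.
have [c' [c'm _ Vc']] := app _ (maxn m.+1 i) V0.
have c'i : c'`_i = 0.
  apply: tame_coef0 c'm _; apply: leq_trans (ltn_expl i (isT : 1 < 2)%N) _.
  by rewrite leq_exp2l// leq_maxr.
have c'm1 : tame m.+1 c' by apply: tame_leq c'm; exact: leq_maxl.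
have := Wdvd (c - c') _ _ i; rewrite coefB c'i subr0; apply.
  by apply: tameD => //; exact: tameN.
rewrite lincombD lincombN.
have -> : phi c - phi c' = (a - phi c') - (a - phi c).
  by rewrite opprB [RHS]addrC addrA subrK.
by apply: VW => //; exact: VN.
Qed.

(* Along [UU] the sequence [x] is Cauchy for the totally bounded topology defined
   by [V]; if [e] is its limit in the completion, the condition says that the
   combinations dominated by [c] satisfy [phi d - e *~ d.[1] \in V j]. Controlling
   all [d] dominated by [c], and not [c] only, is what allows one to divide [c]
   by an integer. *)
Definition controlled V j c := forall d, dominated d c ->
  UU [set i | V j (phi d - x i *~ d.[1])].

Lemma controlledD V j c c' : bohr_chain V ->
  controlled V j.+1 c -> controlled V j.+1 c' -> controlled V j (c + c').
Proof.
move=> [_ _ VD _] Vc Vc' _ /dominated_split[d [d' [-> /Vc Vd /Vc' Vd']]].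
apply: filterS (filterI Vd Vd') => i [Vi Vi'].
by rewrite /= lincombD hornerD mulrzDr opprD addrACA; exact: VD.
Qed.

Lemma controlledN V j c : controlled V j c -> controlled V j (- c).
Proof.
by move=> Vc d dc; apply: Vc => i; have := dc i; rewrite coefN abszN.
Qed.

Lemma controlled0 V j : bohr_chain V -> controlled V j 0.
Proof.
move=> [V0 _ _ _] d d0; have -> : d = 0.
  by apply/polyP => i; have := d0 i; rewrite coef0 => /= ?; lia.
by apply: filterE => i; rewrite /= horner0 mulr0z subr0 /lincomb size_poly0 big_ord0.
Qed.

Lemma controlled_leq V j k c : bohr_chain V -> (j <= k)%N ->
  controlled V k c -> controlled V j c.
Proof.
move=> [V0 _ VD _] jk Vc d /Vc; apply: filterS => i /=.
move: (phi d - x i *~ d.[1]) => z.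
elim: k jk {Vc} => [|k IH]; first by rewrite leqn0 => /eqP->.
rewrite leq_eqVlt => /orP[/eqP->//|jk] Vz; apply: IH => //.
by rewrite -[z]addr0; exact: VD.
Qed.

(** Almost all [x_i] lie in one translate of [V j.+1], and a polynomial dominated by ['X^i] is [0]
    or ['X^i] up to sign. *)
Lemma controlledXn V j : bohr_chain V -> UU [set i | controlled V j 'X^i].
Proof.
move=> [V0 VN VD Vcov].
have [a Fa0] := ultra_covered (fmap_ultra x UUU) (Vcov j.+1).
have Fa : UU [set i | V j.+1 (x i - a)] := Fa0.
apply: filterS (Fa) => i /= Vi d di.
have dE : d = 'X^i *~ d`_i.
  rewrite -scaler_int intz; apply/polyP => k; rewrite coefZ coefXn.
  case: eqP => [->|/eqP ki]; first by rewrite mulr1.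
  by have := di k; rewrite coefXn (negbTE ki) mulr0 /=; lia.
have d1 : d.[1] = d`_i.
  by rewrite {1}dE -scaler_int hornerZ hornerXn expr1n mulr1 intz.
have di1 : (`|(d`_i)%R| <= 1)%N by have := di i; rewrite coefXn eqxx.
apply: filterS (Fa) => k /= Vk.
have Vik : V j (x i - x k).
  have := VD _ _ _ Vi (VN _ _ Vk).
  by rewrite opprB addrA subrK.
rewrite d1 [in phi d]dE lincombMz lincombXn -mulrzBl.
have : d`_i = 0 \/ d`_i = 1 \/ d`_i = -1 by lia.
case=> [->|[->|->]]; rewrite ?mulr0z ?mulr1z ?mulrNz//.
exact: VN.
Qed.

(** Coefficient sum 0 makes differences of the [x_i] small without making the [x_i] small. Finite
    lists of chains can be concatenated, which gives a filter. *)
Definition admissible m L c :=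
  [/\ tame m c, c.[1] = 0 & forall V, List.In V L -> controlled V m c].

Lemma admissible0 m L : (forall V, List.In V L -> bohr_chain V) -> admissible m L 0.
Proof.
move=> hL; split=> [i||V /hL]; rewrite ?coef0 ?horner0//.
exact: controlled0.
Qed.

Lemma admissibleB m L c c' : (forall V, List.In V L -> bohr_chain V) ->
  admissible m.+1 L c -> admissible m.+1 L c' -> admissible m L (c - c').
Proof.
move=> hL [cm c0 cL] [c'm c'0 c'L]; split.
- by apply: tameD => //; exact: tameN.
- by rewrite hornerD hornerN c0 c'0 subr0.
- move=> V VL; apply: controlledD (cL V VL) _; first exact: hL.
  by apply: controlledN; exact: c'L.
Qed.

Lemma admissible_sub m m' L L' c : (forall V, List.In V L' -> bohr_chain V) ->
  (m <= m')%N -> List.incl L L' -> admissible m' L' c -> admissible m L c.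
Proof.
move=> hL mm' LL' [cm c0 cL]; split=> // [|V /LL' VL].
  exact: tame_leq cm.
by apply: controlled_leq (cL V VL) => //; exact: hL.
Qed.

Let Nb (U : set X) m L :=
  [set z | exists u c, [/\ U u, admissible m L c & z = u + phi c]].

Definition cauchy_nbhs0 : set_system X := [set N | exists U m L,
  [/\ nbhs (0 : X) U, forall V, List.In V L -> bohr_chain V & Nb U m L `<=` N]].

#[global] Instance cauchy_nbhs0_filter : Filter cauchy_nbhs0.
Proof.
split.
- by exists setT, 0%N, [::]; split=> //; exact: filterT.
- move=> N N' [U [m [L [U0 hL UN]]]] [U' [m' [L' [U'0 hL' UN']]]].
  have hLL V : List.In V (L ++ L') -> bohr_chain V.
    by move=> /List.in_app_iff[/hL|/hL'].
  exists (U `&` U'), (maxn m m'), (L ++ L'); split=> //; first exact: filterI.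
  move=> _ [u [c [[Uu U'u] cLL ->]]]; split.
    apply: UN; exists u, c; split=> //.
    apply: admissible_sub hLL (leq_maxl _ _) _ cLL.
    by move=> V VL; apply/List.in_app_iff; left.
  apply: UN'; exists u, c; split=> //.
  apply: admissible_sub hLL (leq_maxr _ _) _ cLL.
  by move=> V VL; apply/List.in_app_iff; right.
- move=> N N' NN' [U [m [L [U0 hL UN]]]]; exists U, m, L; split=> //.
  exact: subset_trans NN'.
Qed.

Lemma cauchy_nbhs0_0 N : cauchy_nbhs0 N -> N 0.
Proof.
move=> [U [m [L [U0 hL UN]]]]; apply: UN; exists 0, 0; split.
- exact: nbhs_singleton U0.
- exact: admissible0.
- by rewrite /lincomb size_poly0 big_ord0 addr0.
Qed.

Lemma cauchy_nbhs0B N : cauchy_nbhs0 N ->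
  exists2 M, cauchy_nbhs0 M & forall y z, M y -> M z -> N (y - z).
Proof.
move=> [U [m [L [U0 hL UN]]]]; have [V [V0 VN VU]] := nbhs0_split U0.
exists (Nb V m.+1 L); first by exists V, m.+1, L; split.
move=> _ _ [u [c [Vu cL ->]]] [u' [c' [Vu' c'L ->]]]; apply: UN.
exists (u - u'), (c - c'); split.
- by apply: VU => //; exact: VN.
- exact: admissibleB.
- by rewrite lincombD lincombN opprD addrACA.
Qed.

Lemma cauchy_nbhs0_sub : cauchy_nbhs0 `<=` nbhs (0 : X).
Proof.
move=> N [U [m [L [U0 hL UN]]]]; apply: filterS U0 => u Uu; apply: UN.
exists u, 0; split=> //; first exact: admissible0.
by rewrite /lincomb size_poly0 big_ord0 addr0.
Qed.

Hypothesis sep : forall q, rigid X q -> separated x q.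

(** Otherwise [a] is approximated by [phi c] with [c = d *+ q], where [d] has coefficient sum 0 and
    [phi d] lies in a set that [q] maps into [U]. Then [phi c] and [a - phi c] are in [U], but
    [U + U] misses [a]. *)
Lemma cauchy_nbhs0_separates a : hausdorff_space X -> a != 0 ->
  exists2 N, cauchy_nbhs0 N & ~ N a.
Proof.
move=> hX a0; apply: contrapT => nex.
have Na N : cauchy_nbhs0 N -> N a.
  by move=> cN; apply: contrapT => nNa; apply: nex; exists N.
have [U [U0 UN Ua]] := nbhs0_split (nbhs0_setC1 hX a0).
have [U1 [U10 _ U1U]] := nbhs0_split U0; have [U2 [U20 U2N U2U]] := nbhs0_split U10.
have [U3 [U30 U3N U3U]] := nbhs0_split U20.
have [q rq qU] := rigid_covered U30.
(* Finitely many translates of [E] cover [X], since translates of [U3] cover [qX]; multiplication by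
   [q] maps [4E] into [4 U2], inside [U]. *)
pose E := [set y : X | U2 (y *+ q)].
have [V Vchain VE] : exists2 V, bohr_chain V & V 0%N `<=` nsum E 4.
  apply: bohr_chain_nsum4.
  - by rewrite /E /= mul0rn; exact: nbhs_singleton U20.
  - by move=> y Ey; rewrite /E /= mulNrn; exact: U2N.
  - by apply: covered_preimage_mulrn qU _ => u v Uu /U3N; exact: U3U.
have VU y : V 0%N y -> U (y *+ q).
  move=> /VE[y1 [_ [E1 [y2 [_ [E2 [y3 [_ [E3 [y4 [_ [E4 -> ->]]] ->]]] ->]]] ->]]].
  rewrite addr0 !mulrnDl addrA; apply: U1U; exact: U2U.
have [|c [[c0 Vc] Uc qc]] :=
    @separated_approx q a [set c | c.[1] = 0 /\ controlled V 0 c] (sep rq) _ U U0.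
  move=> W m W0; have : cauchy_nbhs0 (Nb W m [:: V]).
    by exists W, m, [:: V]; split=> // V' [<-|].
  move=> /Na[u [c [Wu [cm c0 cV] ->]]]; exists c; split=> //.
    by split=> //; apply: controlled_leq (leq0n m) (cV V (or_introl erefl)).
  by rewrite addrK.
have [d [cE dc d0]] := dominated_divide qc.
have [i] := filter_ex (Vc d dc); rewrite /= (d0 c0) mulr0z subr0 => /VU.
rewrite -lincombMn -cE => Uphi; apply: (Ua _ _ Uc Uphi).
by rewrite /= subrK.
Qed.

(** [x_i - x_k] is the value of ['X^i - 'X^k], which is admissible for almost all [i] and [k]. *)
Lemma cauchy_nbhs0_cauchy N : cauchy_nbhs0 N -> exists a, UU [set i | N (x i - a)].
Proof.
move=> [U [m [L [U0 hL UN]]]].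
have UL : UU [set i | forall V, List.In V L -> controlled V m.+1 'X^i].
  elim: L hL {UN} => [|V L IH] hL; first by apply: filterE => i V [].
  have VL := controlledXn m.+1 (hL V (or_introl erefl)).
  apply: filterS (filterI VL (IH _)) => [i [Vi Li] W [<-//|/Li//]|W WL].
  by apply: hL; right.
have [k [mk kL]] := filter_ex (filterI (UU_oo (2 ^ m.+1)) UL).
exists (x k); apply: filterS (filterI (UU_oo (2 ^ m.+1)) UL) => i [mi iL]; apply: UN.
exists 0, ('X^i - 'X^k); split; first exact: nbhs_singleton U0.
  split.
  - by apply: tameD; [|apply: tameN]; exact: tameXn.
  - by rewrite hornerD hornerN !hornerXn !expr1n subrr.
  - move=> V VL; apply: controlledD (iL V VL) _; first exact: hL.
    by apply: controlledN; exact: kL.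
by rewrite lincombD lincombN !lincombXn add0r.
Qed.

(** If [a] were a limit, polynomials ['X^i - c] of coefficient sum 1 would approximate it; by
    [separated_approx] one has all coefficients divisible by [q], so [q] divides 1. *)
Lemma cauchy_nbhs0_diverges a : (exists2 q, rigid X q & q != 1%N) ->
  exists2 N, cauchy_nbhs0 N & ~ UU [set i | N (x i - a)].
Proof.
move=> [q rq q1]; apply: contrapT => nex.
have Na N : cauchy_nbhs0 N -> UU [set i | N (x i - a)].
  by move=> cN; apply: contrapT => nNa; apply: nex; exists N.
have [|c [c1 _ qc]] :=
    @separated_approx q a [set c | c.[1] = 1] (sep rq) _ setT filterT.
  move=> W m /nbhs0_opp W0.
  have /Na UNb : cauchy_nbhs0 (Nb [set y | W (- y)] m.+1 [::]).
    by exists [set y | W (- y)], m.+1, [::]; split.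
  have [i [[u [c [Wu [cm c0 _] xE]]] /= mi]] :=
    filter_ex (filterI UNb (UU_oo (2 ^ m.+1))).
  exists ('X^i - c); split.
  - by apply: tameD; [exact: tameXn|exact: tameN].
  - by rewrite /= hornerD hornerN hornerXn expr1n c0 subr0.
  - rewrite lincombD lincombN lincombXn.
    suff -> : a - (x i - phi c) = - u by [].
    by rewrite -[x i](subrK a) xE addrAC addrK opprD addrCA subrr addr0.
have [d [cE _ _]] := dominated_divide qc; case/eqP: q1; apply/eqP.
rewrite -dvdn1; apply/dvdnP; exists `|d.[1]|%N.
have := c1; rewrite /= cE hornerMn pmulrn mulrzz => /(congr1 absz).
by rewrite abszM => /esym.
Qed.
End Core.

Lemma eventually_ultra : exists UU : set_system nat,
  UltraFilter UU /\ forall n, UU [set i | (n <= i)%N].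
Proof.
have [UU [UUU UUoo]] := ultraFilterLemma eventually_filter.
by exists UU; split=> // n; apply: UUoo; exists n.
Qed.

(** * Compactness *)

Section WeaklyComplete.
Variable X : topologicalZmodType.
Hypothesis hX : hausdorff_space X.
Hypothesis cX : forall tau : groupTopology X,
  hausdorff_space (with_topology tau) -> opens tau `<=` @open X ->
  group_complete (with_topology tau).

Lemma filter_complete (NN : set_system X) : Filter NN ->
  (forall N, NN N -> N 0) ->
  (forall N, NN N -> exists2 M, NN M & forall x y, M x -> M y -> N (x - y)) ->
  NN `<=` nbhs (0 : X) -> (forall x, x != 0 -> exists2 N, NN N & ~ N x) ->
  forall F : set_system X, ProperFilter F ->
  (forall N, NN N -> exists x, F [set y | N (y - x)]) ->
  exists x, forall N, NN N -> F [set y | N (y - x)].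
Proof.
move=> NF NN0 NNB Nn sep.
have c : group_complete (with_topology (filter_topology NN0 NNB)).
  by apply: cX; [exact: filter_topology_hausdorff|exact: filter_topology_weaker].
exact: filter_topology_complete c.
Qed.

(** Otherwise [cauchy_nbhs0] defines a weaker Hausdorff group topology in which [x] is Cauchy along
    [UU] but has no limit. *)
Lemma nbhs0_covered U : nbhs (0 : X) U -> covered setT U.
Proof.
move=> U0; apply: contrapT => nU.
have [x sepx] := exists_separated X; have [UU [UUU UUoo]] := eventually_ultra.
have [|||||a aP] := @filter_complete (cauchy_nbhs0 x UU) _ _ _ _ _ (fmap x UU) _.
- exact: cauchy_nbhs0_0.
- exact: cauchy_nbhs0B.
- exact: cauchy_nbhs0_sub.
- by move=> a; exact: cauchy_nbhs0_separates.
- by move=> N; exact: cauchy_nbhs0_cauchy.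
have [|N cN] := cauchy_nbhs0_diverges UUoo sepx a; last by apply; exact: aP.
by apply: rigid_neq1; exists U.
Qed.

(** Total boundedness makes every ultrafilter Cauchy, and completeness in the original topology
    makes it converge. *)
Lemma weakly_complete_compact : compact [set: X].
Proof.
rewrite compact_ultra => F UF _.
have [|||||x xP] := @filter_complete (nbhs (0 : X)) _ _ _ _ _ F _.
- by move=> N; exact: nbhs_singleton.
- move=> N /nbhs0_split[V [V0 VN VNs]]; exists V => // x y Vx Vy.
  by apply: VNs => //; exact: VN.
- by [].
- by move=> a a0; exists (~` [set a]); [exact: nbhs0_setC1|apply].
- by move=> N N0; apply: ultra_covered; exact: nbhs0_covered.
exists x; split=> // A xA.
have : nbhs (0 : X) [set z | A (z - - x)].
  by apply: (@nbhs_translate X (- x)); rewrite sub0r opprK.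
by move=> /xP; apply: filterS => y /=; rewrite opprK subrK.
Qed.
End WeaklyComplete.

(** Small members of a Cauchy filter meet every neighbourhood of a cluster point, hence lie close to
    it. *)
Lemma two_sided_cauchy_cluster (T : topologicalZmodType)
    (F : set_system (two_sided T)) (x : two_sided T) :
  ProperFilter F -> cauchy F -> cluster F x -> F --> x.
Proof.
move=> FF Fc Fx A xA.
have A0 : nbhs (0 : T) [set u | A (u + x)].
  have := @nbhs_translate T (- x) 0 A; rewrite sub0r opprK => /(_ xA).
  by apply: filterS => u.
have [V [V0 VN VA]] := nbhs0_split A0.
have [|[P Q] /= [FP FQ] PQ] :=
    Fc [set yz : T * T | V (- yz.1 + yz.2) /\ V (yz.2 - yz.1)]; first by exists V.
have xV : nbhs x [set y | V (y - x)] by apply: (@nbhs_translate T); rewrite subrr.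
have [p [Pp Vp]] := Fx _ _ FP xV.
apply: filterS FQ => y Qy; have [_ /= Vy] := PQ (p, y) (conj Pp Qy).
by have := VA _ _ Vy Vp; rewrite /= addrA !subrK.
Qed.

Theorem corollary1p3 (X : topologicalZmodType) (hX : hausdorff_space X) :
  compact [set: X] <->
  (forall tau : groupTopology X,
     hausdorff_space (with_topology tau) ->
     opens tau `<=` @open X ->
     group_complete (with_topology tau)).
Proof.
split=> [cptX tau _ weaker F FF Fc|]; last exact: weakly_complete_compact.
(* A cluster point for the topology of [X] is also one for [tau], whose neighbourhoods are
   neighbourhoods in [X]. *)
have [x [_ Fx]] := cptX F FF filterT.
exists x; apply: two_sided_cauchy_cluster => // P B FP xB; apply: Fx => //.
move: xB; rewrite !nbhsE => -[O [oO Ox] OB]; exists O => //; split=> //.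
exact: weaker.
Qed.
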